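(* Let $\mathcal F$ be a tensor format. Then $\mathcal F$ is closed if and only if, for all possible rank vectors $\mathbf r=(r_0,\dots,r_L)$, every stable, convergent sequence in $\mathrm{MS}_{\mathcal F_{\mathbf r}}$ converges to a tensor in $\mathrm{MS}_{\mathcal F_{\mathbf r}}$.
   Context: Fix integers $b_s\ge2$, $d\ge1$, $L\ge0$. A tensor format $\mathcal F$ (e.g. canonical or tensor-train format) assigns to each rank bound $r$ and each $k\in\{0,\dots,L\}$ the set $\mathcal F_r\subseteq\mathbb{R}^{b_s^k\times\dots\times b_s^k}$ ($d$ factors) of tensors of that size with $\mathcal F$-rank at most $r$; the rank bound $0$ is allowed and $\mathcal F_0=\{0\}$. $\mathcal F$ is called closed if all these sets $\mathcal F_r$ (for every $r$ and every size $b_s^k$, $0\le k\le L$) are closed in the usual topology. For $A\in\mathbb{R}^{b_s^k\times\dots\times b_s^k}$ and $\ell\ge0$, $\mathrm{ext}_\ell(A)\in\mathbb{R}^{b_s^{k+\ell}\times\dots\times b_s^{k+\ell}}$ is $\mathrm{ext}_\ell(A)(i_1,\dots,i_d)=A(\lfloor (i_1-1)/b_s^\ell\rfloor+1,\dots,\lfloor (i_d-1)/b_s^\ell\rfloor+1)$. For a vector $\mathbf r=(r_0,\dots,r_L)$ of rank bounds, the multiresolution format is $$\mathrm{MS}_{\mathcal F_{\mathbf r}}=\Big\{\sum_{k=0}^L\mathrm{ext}_{L-k}(T_k):\ T_k\in\mathcal F_{r_k},\ T_k\in\mathbb{R}^{b_s^k\times\dots\times b_s^k}\Big\}.$$ A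 sequence of tensors $T^{(n)}=\sum_{k=0}^L\mathrm{ext}_{L-k}(T_k^{(n)})$ in $\mathrm{MS}_{\mathcal F_{\mathbf r}}$ (with $T_k^{(n)}\in\mathcal F_{r_k}$ of side lengths $b_s^k$) is called stable if there is a constant $C<\infty$ such that $\|T_k^{(n)}\|\le C\|T^{(n)}\|$ for every $k=0,\dots,L$ and every $n$, where $\|\cdot\|$ is the Frobenius norm. *)

(* Defs.v *)
From HB Require Import structures.
From mathcomp Require Import all_boot all_order all_algebra.
From mathcomp Require Import all_classical all_reals all_analysis.

Set Implicit Arguments.
Unset Strict Implicit.
Unset Printing Implicit Defensive.

Import Order.TTheory GRing.Theory Num.Theory.
Import numFieldNormedType.Exports.

Local Open Scope classical_set_scope.
Local Open Scope ring_scope.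

(* Indices run over {0, ..., n-1} instead of {1, ..., n}. The index set is
   finite, so the product topology carried by {ptws _ -> _} is the usual
   (norm) topology of R^(n x ... x n). *)
Definition tensor (R : realType) (d n : nat) : Type :=
  {ptws {ffun 'I_d -> 'I_n} -> R}.

HB.instance Definition _ (R : realType) (d n : nat) :=
  Topological.copy (tensor R d n) {ptws {ffun 'I_d -> 'I_n} -> R}.

Definition frobenius (R : realType) (d n : nat) (A : tensor R d n) : R :=
  Num.sqrt (\sum_(i : {ffun 'I_d -> 'I_n}) A i ^+ 2).

Lemma coarse_subproof (b k m : nat) (hkm : (k <= m)%N) (i : 'I_(b ^ m)%N) :
  (i %/ b ^ (m - k) < b ^ k)%N.
Proof.
have hm : (b ^ m = b ^ k * b ^ (m - k))%N by rewrite -expnD subnKC.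
have hi := ltn_ord i; rewrite {2}hm in hi.
by rewrite ltn_divLR//; case: (b ^ (m - k))%N hi => //; rewrite muln0.
Qed.

(* With 0-based indices, floor((i - 1) / b^l) + 1 becomes i %/ b^l. *)
Definition coarse (b k m : nat) (hkm : (k <= m)%N) (i : 'I_(b ^ m)%N) :
    'I_(b ^ k)%N :=
  Ordinal (coarse_subproof hkm i).

(* ext_l with l = m - k; indexing by the target level m rather than by l
   avoids a cast along k + (L - k) = L. *)
Definition ext (R : realType) (b d k m : nat) (hkm : (k <= m)%N)
    (A : tensor R d (b ^ k)%N) : tensor R d (b ^ m)%N :=
  fun i => A [ffun j => coarse hkm (i j)].

(* fmt r k is the set of tensors of side length b^k and rank at most r. The
   rank bounds form a poset B with least element 0: B = nat for the canonical
   format, tuples of naturals for the tensor-train format. There is no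
   rank function with values in B because in general formats a tensor need not
   have a least admissible rank bound. *)
Unset Implicit Arguments.
Record tensor_format (R : realType) (b d L : nat) (disp : Order.disp_t)
    (B : bPOrderType disp) := TensorFormat {
  fmt :> B -> forall k : 'I_L.+1, set (tensor R d (b ^ k)%N);
  fmt_mono : forall (r s : B) (k : 'I_L.+1),
    (r <= s)%O -> fmt r k `<=` fmt s k;
  fmt_bot : forall k : 'I_L.+1, fmt \bot%O k = [set fun=> 0]
}.
Set Implicit Arguments.
Arguments fmt {R b d L disp B} _ _ _ _.
Arguments tensor_format R b d L {disp} B.

Definition closed_format (R : realType) (b d L : nat) (disp : Order.disp_t)
    (B : bPOrderType disp) (F : tensor_format R b d L B) : Prop :=
  forall (r : B) (k : 'I_L.+1), closed (F r k).

Definition ms_sum (R : realType) (b d L : nat)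
    (T : forall k : 'I_L.+1, tensor R d (b ^ k)%N) : tensor R d (b ^ L)%N :=
  fun i => \sum_(k < L.+1) ext (leq_ord k) (T k) i.

Definition MS (R : realType) (b d L : nat) (disp : Order.disp_t)
    (B : bPOrderType disp) (F : tensor_format R b d L B)
    (r : 'I_L.+1 -> B) : set (tensor R d (b ^ L)%N) :=
  [set ms_sum T | T in [set T : forall k : 'I_L.+1, tensor R d (b ^ k)%N |
                         forall k, F (r k) k (T k)]].

Definition stable_sequence (R : realType) (b d L : nat) (disp : Order.disp_t)
    (B : bPOrderType disp) (F : tensor_format R b d L B) (r : 'I_L.+1 -> B)
    (T : nat -> tensor R d (b ^ L)%N) : Prop :=
  exists Tk : nat -> forall k : 'I_L.+1, tensor R d (b ^ k)%N,
    [/\ forall n k, F (r k) k (Tk n k),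
        forall n, T n = ms_sum (Tk n) &
        exists C : R, forall n k, frobenius (Tk n k) <= C * frobenius (T n)].

(* Main.v *)
(* If the format is closed, stability bounds every component T_k^(n) along a
   convergent sequence; by compactness all components converge along one
   ultrafilter refining n -> oo, the limits stay in the closed sets F_(r_k), and
   their extensions sum to the limit tensor. Conversely, if all ranks but r_k are
   0, then MS consists of the tensors ext_(L-k)(A) with A in F_(r_k). As ext_(L-k)
   is injective, continuous and does not decrease the Frobenius norm, it maps a
   convergent sequence in F_(r_k) to a stable convergent one, so F_(r_k) is
   closed. *)

Require Import Defs.
From mathcomp Require Import all_boot all_order all_algebra.
From mathcomp Require Import all_classical all_reals all_analysis.

Set Implicit Arguments.
Unset Strict Implicit.
Unset Printing Implicit Defensive.

Import Order.TTheory GRing.Theory Num.Theory.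
Import numFieldNormedType.Exports.

Local Open Scope classical_set_scope.
Local Open Scope ring_scope.

Lemma ultra_fmap (S T : Type) (f : S -> T) (U : set_system S) :
  UltraFilter U -> UltraFilter (f @ U).
Proof.
move=> UU; have PU := @ultra_proper _ _ UU.
split=> [|G PG sUG]; first exact: fmap_proper_filter.
rewrite eqEsubset; split=> // A GA.
have [//|nA] := in_ultra_setVsetC (f @^-1` A) UU.
have GnA : G (~` A) by exact: sUG.
by have [x []] := filter_ex (filterI GA GnA).
Qed.

Lemma cvg_sumr (R : realType) (S : Type) (F : set_system S) {FF : Filter F}
    (I : finType) (f : I -> S -> R) (a : I -> R) :
  (forall i, f i x @[x --> F] --> a i) ->
  \sum_i f i x @[x --> F] --> \sum_i a i.
Proof.
move=> fa.
by apply: (@cvg_big R _ +%R 0 xpredT (@add_continuous R)) => i _; exact: fa.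
Qed.

Section Tensor.
Variables (R : realType) (d n : nat).
Implicit Types A B : tensor R d n.

(** The topology is the supremum of those induced by the coordinate projections. Each projection is
    onto, as constant tensors show, so [cvg_image] applies to it. *)
Lemma tensor_cvgP (S : Type) (F : set_system S) {FF : Filter F}
    (u : S -> tensor R d n) A :
  (u @ F --> A) <-> (forall i, u x i @[x --> F] --> A i).
Proof.
split=> [uA i|uA].
  apply: (@cvg_comp _ _ _ u (fun B : tensor R d n => B i) _ _ _ uA).
  exact: (@proj_continuous _ (fun=> R : topologicalType) i A).
apply/cvg_sup => i; apply/cvg_image.
  by rewrite eqEsubset; split=> // y _; exists (fun=> y).
move=> P /uA FP; exists [set B : tensor R d n | P (B i)] => //.
rewrite eqEsubset; split=> [_ [B PB <-] //|y Py].
by exists (fun=> y).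
Qed.

Lemma frobenius_cvg (S : Type) (F : set_system S) {FF : Filter F}
    (u : S -> tensor R d n) A :
  u @ F --> A -> frobenius (u x) @[x --> F] --> frobenius A.
Proof.
move=> /tensor_cvgP uA; rewrite /frobenius.
suff sumA : \sum_i u x i ^+ 2 @[x --> F] --> \sum_i A i ^+ 2.
  exact: (cvg_comp _ _ sumA (@sqrt_continuous R (\sum_i A i ^+ 2))).
apply: cvg_sumr => i.
exact: (cvg_comp _ _ (uA i) (@exprn_continuous R 2 (A i))).
Qed.

Lemma frobenius0 : frobenius ((fun=> 0) : tensor R d n) = 0.
Proof. by rewrite /frobenius big1 ?sqrtr0// => i _; rewrite expr0n. Qed.

Lemma normr_le_frobenius A i : `|A i| <= frobenius A.
Proof.
rewrite -sqrtr_sqr ler_wsqrtr// (bigD1 i)//= lerDl sumr_ge0// => j _.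
exact: sqr_ge0.
Qed.

Lemma compact_tensor_bounded (M : R) :
  compact [set A : tensor R d n | forall i, `[- M, M]%classic (A i)].
Proof.
exact: (@tychonoff _ (fun=> R : topologicalType) (fun=> `[- M, M]%classic)
  (fun=> @segment_compact _ _ _)).
Qed.

(** Each entry is bounded by the Frobenius norm, so the image ultrafilter contains a box that is
    compact by Tychonoff. *)
Lemma ultra_frobenius_bounded_cvg (S : Type) (U : set_system S)
    (u : S -> tensor R d n) (M : R) :
  UltraFilter U -> (\forall x \near U, frobenius (u x) <= M) ->
  exists A, u @ U --> A.
Proof.
move=> UU uM; have PU := @ultra_proper _ _ UU.
have := @compact_tensor_bounded M; rewrite compact_ultra.
case/(_ _ (ultra_fmap u UU)) => [|A [_ uA]]; last by exists A.
apply: filterS uM => x uxM i /=.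
by rewrite in_itv/= -ler_norml (le_trans (normr_le_frobenius _ _)).
Qed.

(** With finitely many indices, the entrywise ball of radius [m.+1%:R^-1] is a neighbourhood of [A];
    a point of [D] is chosen in each. *)
Lemma closure_tensor_seq (D : set (tensor R d n)) A : closure D A ->
  exists2 u : nat -> tensor R d n, forall m, D (u m) & u @ \oo --> A.
Proof.
move=> clA.
have near_A (m : nat) : exists B, D B /\ forall i, `|A i - B i| < m.+1%:R^-1.
  have [|B [DB AB]] := clA [set B | forall i, `|A i - B i| < m.+1%:R^-1];
    last by exists B.
  apply: (@filter_forall _ _ _ (nbhs A)) => i.
  have /tensor_cvgP/(_ i) : (id : tensor R d n -> _) @ A --> A by exact: cvg_id.
  by move=> /cvgrPdist_lt/(_ _ _); apply; rewrite invr_gt0.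
exists (fun m => projT1 (cid (near_A m))) => [m|].
  by case: cid => B [].
apply/tensor_cvgP => i; apply/cvgrPdist_lt => e e0.
near=> m; case: cid => B /= [_ /(_ i)] /lt_trans; apply.
near: m; exact: near_infty_natSinv_lt (PosNum e0).
Unshelve. all: by end_near. Qed.

End Tensor.

Section Ext.
Variables (R : realType) (b d : nat).
Hypothesis b_gt0 : (0 < b)%N.

Lemma coarse_surj (k m : nat) (hkm : (k <= m)%N) (i : 'I_(b ^ k)%N) :
  exists j : 'I_(b ^ m)%N, coarse hkm j = i.
Proof.
(* The witness is the first fine index of the block that coarsens to [i]. *)
have ltj : (i * b ^ (m - k) < b ^ m)%N.
  rewrite -[X in (_ < b ^ X)%N](subnKC hkm) expnD.
  by rewrite ltn_pmul2r ?expn_gt0 ?b_gt0.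
by exists (Ordinal ltj); apply/val_inj; rewrite /= mulnK ?expn_gt0 ?b_gt0.
Qed.

(** Every entry of [A] reappears in [ext hkm A] at a position given by [g]; both injectivity and the
    norm bound for [ext] rest on this. *)
Lemma coarse_section (k m : nat) (hkm : (k <= m)%N) :
  exists g : {ffun 'I_d -> 'I_(b ^ k)%N} -> {ffun 'I_d -> 'I_(b ^ m)%N},
    cancel g (fun i => [ffun j => coarse hkm (i j)]).
Proof.
have [s sK] := choice (coarse_surj hkm).
exists (fun i => [ffun j => s (i j)]) => i.
by apply/ffunP => j; rewrite !ffunE sK.
Qed.

Lemma ext_inj (k m : nat) (hkm : (k <= m)%N) : injective (@ext R b d k m hkm).
Proof.
have [g gK] := coarse_section hkm.
move=> A B AB; apply/funext => i.
rewrite -(gK i).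
exact: (congr1 (fun T : tensor R d (b ^ m)%N => T (g i)) AB).
Qed.

Lemma frobenius_le_ext (k m : nat) (hkm : (k <= m)%N)
    (A : tensor R d (b ^ k)%N) : frobenius A <= frobenius (ext hkm A).
Proof.
have [g gK] := coarse_section hkm.
rewrite ler_wsqrtr//.
(* As [g] is injective, the left sum is the part of the right one over the image of [g]; what
   remains is a sum of squares. *)
have -> : \sum_i A i ^+ 2 =
    \sum_(j in (g @: predT)%SET) ext hkm A j ^+ 2.
  rewrite big_imset/=; last by move=> ? ? _ _; exact: can_inj gK _ _.
  apply: eq_big => [i|i _]; first by rewrite inE.
  by rewrite -[in LHS](gK i).
rewrite [leRHS](bigID [in (g @: predT)%SET])/= lerDl.
by apply: sumr_ge0 => j _; exact: sqr_ge0.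
Qed.

Lemma ext_cvg (k m : nat) (hkm : (k <= m)%N) (S : Type)
    (F : set_system S) {FF : Filter F} (u : S -> tensor R d (b ^ k)%N)
    (A : tensor R d (b ^ k)%N) :
  u @ F --> A -> ext hkm (u x) @[x --> F] --> ext hkm A.
Proof. by move=> /tensor_cvgP uA; apply/tensor_cvgP => i; exact: uA. Qed.

End Ext.

Section MsSum.
Variables (R : realType) (b d L : nat).

Lemma ms_sum_cvg (S : Type) (F : set_system S) {FF : Filter F}
    (u : S -> forall k : 'I_L.+1, tensor R d (b ^ k)%N)
    (A : forall k : 'I_L.+1, tensor R d (b ^ k)%N) :
  (forall k, u x k @[x --> F] --> A k) ->
  ms_sum (u x) @[x --> F] --> ms_sum A.
Proof.
move=> uA; apply/tensor_cvgP => i.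
apply: cvg_sumr => k.
exact: (tensor_cvgP _ _).1 (uA k) _.
Qed.

(** The type of a component depends on its scale, so the dependent update [dfwith] is used to avoid
    a cast. *)
Definition single_scale (k : 'I_L.+1) (A : tensor R d (b ^ k)%N)
    (l : 'I_L.+1) : tensor R d (b ^ l)%N :=
  dfwith (fun l : 'I_L.+1 => (fun=> 0) : tensor R d (b ^ l)%N) k A l.

Lemma ms_sum_single (k : 'I_L.+1)
    (T : forall l : 'I_L.+1, tensor R d (b ^ l)%N) :
  (forall l, l != k -> T l = fun=> 0) -> ms_sum T = ext (leq_ord k) (T k).
Proof.
move=> T0; apply/funext => i.
by rewrite /ms_sum (bigD1 k)//= big1 ?addr0// => l lk; rewrite T0.
Qed.

End MsSum.

Unset Implicit Arguments.

Theorem theorem4p3 (R : realType) (b d L : nat) (hb : (2 <= b)%N)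
    (hd : (1 <= d)%N) (disp : Order.disp_t) (B : bPOrderType disp)
    (F : tensor_format R b d L B) :
  closed_format F <->
  (forall (r : 'I_L.+1 -> B) (T : nat -> tensor R d (b ^ L)%N)
      (S : tensor R d (b ^ L)%N),
    stable_sequence F r T -> T @ \oo --> S -> MS F r S).
Proof.
have b_gt0 : (0 < b)%N by exact: ltnW.
split=> [clF r T S [Tk [FTk TE [C TkC]]] TS|MSF r0 k0].
  (* A single [U] serves all scales at once, where subsequences would have to be extracted scale by
     scale. *)
  have [U [UU sooU]] := @ultraFilterLemma nat \oo _.
  have PU := @ultra_proper _ _ UU.
  have TUS : T @ U --> S by apply: cvg_trans TS => P /= /sooU.
  have bounded k : \forall n \near U,
      frobenius (Tk n k) <= `|C| * (`|frobenius S| + 1).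
    (* The norms of [T n] converge to that of [S], hence are eventually within this bound. The sign
       of [C] is unknown, whence [|C|] in the estimate. *)
    have lt_bound : `|frobenius S| < `|frobenius S| + 1 by rewrite ltrDl.
    apply: filterS (cvgr_norm_le _ (frobenius_cvg TUS) _ lt_bound) => n Tn.
    apply: le_trans (TkC n k) _.
    by rewrite (le_trans (ler_norm _))// normrM ler_wpM2l.
  have limit k := cid (ultra_frobenius_bounded_cvg UU (bounded k)).
  pose A k := projT1 (limit k).
  have TkA k : Tk n k @[n --> U] --> A k := projT2 (limit k).
  exists A => [k|].
    exact: (closed_cvg _ (clF (r k) k) (nearW _ (FTk^~ k)) _ (TkA k)).
  have TUA : T @ U --> ms_sum A.
    by rewrite (funext TE); exact: ms_sum_cvg.
  apply/funext => i.
  move/tensor_cvgP/(_ i) : TUA => TUAi; move/tensor_cvgP/(_ i) : TUS => TUSi.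
  exact: (cvg_unique (@Rhausdorff R) TUAi TUSi).
move=> A /closure_tensor_seq[u Fu uA].
pose r k := if k == k0 then r0 else \bot%O.
have [||T FT TA] := MSF r (ext (leq_ord k0) \o u) (ext (leq_ord k0) A).
- exists (fun n => single_scale (u n)); split=> [n k|n|].
  + rewrite /single_scale /r; case: dfwithP => [|l]; first by rewrite eqxx.
    by rewrite eq_sym => /negbTE->; rewrite fmt_bot.
  + rewrite (@ms_sum_single _ _ _ _ k0) /single_scale ?dfwithin// => l lk0.
    by rewrite dfwithout// eq_sym.
  (* The constant 1 suffices: [ext] does not decrease the norm, and the other components vanish. *)
  + exists 1 => n k; rewrite mul1r /single_scale.
    case: dfwithP => [|l _]; first exact: frobenius_le_ext.
    by rewrite frobenius0 sqrtr_ge0.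
- exact: ext_cvg.
(* The decomposition [T] supplied by [MSF] is arbitrary, but rank bound [\bot] kills it away from
   [k0]; so [ext] takes the same value at [T k0] and [A]. *)
have T0 k : k != k0 -> T k = fun=> 0.
  by move=> kk0; have := FT k; rewrite /r (negbTE kk0) fmt_bot.
suff <- : T k0 = A by have := FT k0; rewrite /r eqxx.
by apply: (ext_inj b_gt0 (hkm := leq_ord k0)); rewrite -ms_sum_single.
Qed.
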